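(* For any finite set $X$, the following inclusion always holds and equality never occurs: $$\mathcal{R}\text{-}\mathrm{Geo}(\mathrm{FIM}_X)\cup \mathcal{L}\text{-}\mathrm{Geo}(\mathrm{FIM}_X)\subsetneq \mathcal{H}\text{-}\mathrm{Geo}(\mathrm{FIM}_X).$$ Specifically, for $a\in X$, the word $a^2a^{-4}a$ belongs to $\mathcal{H}\text{-}\mathrm{Geo}(\mathrm{FIM}_X)$, but not to $\mathcal{L}\text{-}\mathrm{Geo}(\mathrm{FIM}_X)$ and also not to $\mathcal{R}\text{-}\mathrm{Geo}(\mathrm{FIM}_X)$.
   Context: $\mathrm{FIM}_X$ is the free inverse monoid on $X$; $\tilde X=X\cup X^{-1}$ with $X^{-1}=\{x^{-1}:x\in X\}$ a disjoint copy of $X$; $\pi:\tilde X^*\to \mathrm{FIM}_X$ is the canonical surjective homomorphism; $\ell(w)$ is the length of the word $w$; in words over $\tilde X$, $a^{-n}$ denotes $(a^{-1})^n$. On a monoid $S$, the Green's relations are: $s\,\mathcal{R}\,t$ iff $sS=tS$; $s\,\mathcal{L}\,t$ iff $Ss=St$; and $\mathcal{H}=\mathcal{L}\cap\mathcal{R}$. For $\mathcal{K}\in\{\mathcal{H},\mathcal{R},\mathcal{L}\}$ the corresponding Green's relation on $\mathrm{FIM}_X$, $$\mathcal{K}\text{-}\mathrm{Geo}(\mathrm{FIM}_X)=\bigl\{w\in\tilde X^*: \ell(w)=\min\{\ell(u): u\in\tilde X^*,\ (u\pi)\,\mathcal{K}\,(w\pi)\}\bigr\}.$$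
   Formalization: The claim that equality never occurs is proved for nonempty finite X only; for X empty the only word is the empty word, all three sets coincide and equality holds. *)

(* Defs.v *)
From HB Require Import structures.
From mathcomp Require Import all_boot.
From mathcomp Require Import boolp classical_sets.
Set Implicit Arguments.
Unset Strict Implicit.
Unset Printing Implicit Defensive.

Local Open Scope classical_set_scope.
Local Open Scope group_scope.
Local Open Scope quotient_scope.

Section Green.
Variable S : monoidType.
Implicit Types s t : S.

Definition greenR s t : Prop :=
  [set s * x | x in [set: S]] = [set t * x | x in [set: S]].

Definition greenL s t : Prop :=
  [set x * s | x in [set: S]] = [set x * t | x in [set: S]].

Definition greenH s t : Prop := greenL s t /\ greenR s t.

End Green.

Section FreeInverseMonoid.
Variable X : choiceType.

(* The alphabet X u X^-1: inl x is the letter x and inr x the letter x^-1.   *)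
Definition letter : Type := (X + X)%type.
HB.instance Definition _ := Choice.on letter.

Definition letter_inv (l : letter) : letter :=
  match l with inl x => inr x | inr x => inl x end.

Definition word : Type := seq letter.
HB.instance Definition _ := Choice.on word.

Definition word_inv (w : word) : word := rev (map letter_inv w).

(* The Vagner congruence: the congruence on words generated by the pairs     *)
(* (u, u u^-1 u) and (u u^-1 v v^-1, v v^-1 u u^-1).                         *)
Inductive vagner : word -> word -> Prop :=
| vagner_regular u : vagner u (u ++ word_inv u ++ u)
| vagner_commute u v :
    vagner (u ++ word_inv u ++ v ++ word_inv v)
           (v ++ word_inv v ++ u ++ word_inv u)
| vagner_cat u u' v v' : vagner u u' -> vagner v v' -> vagner (u ++ v) (u' ++ v')
| vagner_refl u : vagner u u
| vagner_sym u v : vagner u v -> vagner v u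
| vagner_trans v u w : vagner u v -> vagner v w -> vagner u w.

(* Quotients are taken by boolean relations, hence the classical `[< >].     *)
Definition vagnerb : rel word := fun u v => `[< vagner u v >].

Lemma vagnerb_refl : reflexive vagnerb.
Proof. by move=> u; apply/asboolP; exact: vagner_refl. Qed.

Lemma vagnerb_sym : symmetric vagnerb.
Proof. by move=> u v; apply/asboolP/asboolP; exact: vagner_sym. Qed.

Lemma vagnerb_trans : transitive vagnerb.
Proof.
by move=> v u w /asboolP uv /asboolP vw; apply/asboolP/(vagner_trans uv).
Qed.

Canonical vagner_equiv :=
  EquivRel vagnerb vagnerb_refl vagnerb_sym vagnerb_trans.

Definition FIM : Type := {eq_quot vagner_equiv}.
HB.instance Definition _ := Choice.on FIM.
HB.instance Definition _ := EqQuotient.on FIM.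

Definition fim_pi (w : word) : FIM := \pi_FIM w.

Lemma fim_piP u v : fim_pi u = fim_pi v <-> vagner u v.
Proof. by split=> [/eqmodP/asboolP | ?]; last exact/eqmodP/asboolP. Qed.

Lemma fim_pi_surj s : exists w, s = fim_pi w.
Proof. by exists (repr s); rewrite /fim_pi reprK. Qed.

Definition fim_mul (s t : FIM) : FIM := fim_pi (repr s ++ repr t).

Lemma fim_mulE u v : fim_mul (fim_pi u) (fim_pi v) = fim_pi (u ++ v).
Proof. by apply/fim_piP/vagner_cat; apply/fim_piP; rewrite /fim_pi reprK. Qed.

Lemma fim_mulA : associative fim_mul.
Proof.
move=> s t r; have [[u ->] [v ->]] := (fim_pi_surj s, fim_pi_surj t).
by have [w ->] := fim_pi_surj r; rewrite !fim_mulE catA.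
Qed.

Lemma fim_mul1 : left_id (fim_pi [::]) fim_mul.
Proof. by move=> s; have [u ->] := fim_pi_surj s; rewrite fim_mulE. Qed.

Lemma fim_1mul : right_id (fim_pi [::]) fim_mul.
Proof. by move=> s; have [u ->] := fim_pi_surj s; rewrite fim_mulE cats0. Qed.

HB.instance Definition _ := isMonoid.Build FIM fim_mulA fim_mul1 fim_1mul.

Lemma fim_piM u v : fim_pi (u ++ v) = fim_pi u * fim_pi v.
Proof. by rewrite -fim_mulE. Qed.

Lemma fim_pi1 : fim_pi [::] = 1.
Proof. by []. Qed.

Definition Geo (K : FIM -> FIM -> Prop) : set word :=
  [set w | let lengths := [set size u | u in [set u | K (fim_pi u) (fim_pi w)]]
           in lengths (size w) /\ forall n, lengths n -> size w <= n].

End FreeInverseMonoid.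

Arguments FIM X : clear implicits.

(* The quotient by the Vagner congruence is the free inverse monoid: FIM_inverse
   and FIM_free below are its defining properties.                           *)

Definition mutually_inverse (S : monoidType) (s t : S) : Prop :=
  s * t * s = s /\ t * s * t = t.

Definition inverse_monoid (S : monoidType) : Prop :=
  forall s : S, exists! t, mutually_inverse s t.

Section FIMInverse.
Variable X : choiceType.
Implicit Types (u v : word X) (s t e f : FIM X).

Lemma word_invK : involutive (@word_inv X).
Proof.
move=> u; rewrite /word_inv map_rev revK -map_comp map_id_in // => l _.
by case: l.
Qed.

Lemma word_inv_cat u v : word_inv (u ++ v) = word_inv v ++ word_inv u.
Proof. by rewrite /word_inv map_cat rev_cat. Qed.

Lemma vagner_inv u v : vagner u v -> vagner (word_inv u) (word_inv v).
Proof.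
elim=> {u v} [u|u v|u u' v v' _ h _ h'|u|u v _ h|v u w _ h _ h'].
- rewrite !word_inv_cat word_invK -catA -[X in _ ++ X ++ _]word_invK.
  exact: vagner_regular.
- by rewrite !word_inv_cat !word_invK -!catA; exact: vagner_commute.
- by rewrite !word_inv_cat; exact: vagner_cat.
- exact: vagner_refl.
- exact: vagner_sym.
- exact: vagner_trans h h'.
Qed.

Lemma fim_piVK u : fim_pi u * fim_pi (word_inv u) * fim_pi u = fim_pi u.
Proof. by rewrite -!fim_piM -catA; apply/fim_piP/vagner_sym/vagner_regular. Qed.

Lemma fim_proj_comm u v :
  fim_pi u * fim_pi (word_inv u) * (fim_pi v * fim_pi (word_inv v)) =
  fim_pi v * fim_pi (word_inv v) * (fim_pi u * fim_pi (word_inv u)).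
Proof. by rewrite -!fim_piM -!catA; apply/fim_piP/vagner_commute. Qed.

Lemma fim_idem_proj e : e * e = e ->
  exists u, e = fim_pi u * fim_pi (word_inv u).
Proof.
have [u ->] := fim_pi_surj e => ee; exists u.
have yxy := fim_piVK (word_inv u); have xyx := fim_piVK u.
have comm := fim_proj_comm u (word_inv u).
have yy : fim_pi (word_inv u) * fim_pi (word_inv u) = fim_pi (word_inv u).
  rewrite -fim_piM -word_inv_cat; apply/fim_piP/vagner_inv/fim_piP.
  by rewrite fim_piM.
rewrite word_invK in yxy comm.
move: (fim_pi u) (fim_pi (word_inv u)) => x y in ee yxy xyx comm yy *.
suff yE : y = x by rewrite yE ee.
by rewrite -yxy -{1}ee !mulgA -(mulgA (y * x)) -comm mulgA -(mulgA x y y) yy xyx.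
Qed.

Lemma fim_idem_comm e f : e * e = e -> f * f = f -> e * f = f * e.
Proof.
by move=> /fim_idem_proj[u ->] /fim_idem_proj[v ->]; exact: fim_proj_comm.
Qed.

Lemma FIM_inverse : inverse_monoid (FIM X).
Proof.
move=> s; have [u ->] := fim_pi_surj s; exists (fim_pi (word_inv u)).
have srs := fim_piVK u; have := fim_piVK (word_inv u); rewrite word_invK.
move: (fim_pi u) (fim_pi (word_inv u)) srs => {u}s r srs rsr.
split=> // t [sts tst].
have E1 : s * t * (s * r) = s * r * (s * t).
  by apply: fim_idem_comm; rewrite mulgA ?srs ?sts.
have E2 : t * s * (r * s) = r * s * (t * s).
  by apply: fim_idem_comm; rewrite mulgA ?rsr ?tst.
transitivity (r * s * t).
  transitivity (r * (s * t * (s * r))).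
    by rewrite -[LHS]rsr -{1}sts !mulgA.
  by rewrite E1 !mulgA rsr.
transitivity (r * s * (t * s) * t); first by rewrite -!mulgA (mulgA t) tst.
by rewrite -E2 -!mulgA (mulgA s) (mulgA (s * r)) srs (mulgA t) tst.
Qed.

End FIMInverse.

Section FIMFree.
Variables (X : choiceType) (S : monoidType).
Hypothesis S_inverse : inverse_monoid S.
Variable f : X -> S.
Implicit Types s t e : S.

Let inv s : S := sval (cid (S_inverse s)).

Let invP s : mutually_inverse s (inv s).
Proof. by have [] := svalP (cid (S_inverse s)). Qed.

Let inv_uniq s t : mutually_inverse s t -> inv s = t.
Proof. by have [_] := svalP (cid (S_inverse s)); exact. Qed.

Let idem_comm e e' : e * e = e -> e' * e' = e' -> e * e' = e' * e.
Proof.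
have idem_mul (a b : S) : a * a = a -> b * b = b -> a * b * (a * b) = a * b.
  move=> aa bb; have [] := invP (a * b); set x := inv (a * b) => h1 h2.
  have xabx : b * x * a * (b * x * a) = b * x * a.
    by rewrite -[in RHS]h2 !mulgA.
  have xE : x = b * x * a.
    apply: inv_uniq; split.
      by rewrite -[RHS]h1 !mulgA -(mulgA a b b) bb -(mulgA _ a a) aa.
    by rewrite !mulgA -(mulgA _ a a) aa -(mulgA _ b b) bb -[RHS]xabx !mulgA.
  have xx : x * x = x by rewrite xE xabx.
  have <- : inv x = a * b by apply: inv_uniq.
  have -> : inv x = x by apply: inv_uniq; split; rewrite !xx.
  exact: xx.
move=> ee ee'; have h := idem_mul _ _ ee ee'; have h' := idem_mul _ _ ee' ee.
transitivity (inv (e * e')).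
  by apply/esym/inv_uniq; split; rewrite h.
apply: inv_uniq; split.
  by rewrite -[RHS]h !mulgA -(mulgA e e' e') ee' -(mulgA _ e e) ee.
by rewrite -[RHS]h' !mulgA -(mulgA e' e e) ee -(mulgA _ e' e') ee'.
Qed.

Let invK : involutive inv.
Proof. by move=> s; apply: inv_uniq; have [] := invP s. Qed.

Let idem_r s : s * inv s * (s * inv s) = s * inv s.
Proof. by rewrite mulgA (invP s).1. Qed.

Let idem_l s : inv s * s * (inv s * s) = inv s * s.
Proof. by rewrite mulgA (invP s).2. Qed.

Let invM s t : inv (s * t) = inv t * inv s.
Proof.
have c := idem_comm (idem_r t) (idem_l s).
apply: inv_uniq; split.
  transitivity (s * (t * inv t * (inv s * s)) * t); first by rewrite !mulgA.
  by rewrite c !mulgA (invP s).1 -!mulgA (mulgA t) (invP t).1.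
transitivity (inv t * (inv s * s * (t * inv t)) * inv s); first by rewrite !mulgA.
by rewrite -c !mulgA (invP t).2 -!mulgA (mulgA (inv s)) (invP s).2.
Qed.

Let inv1 : inv 1 = 1.
Proof. by apply: inv_uniq; split; rewrite !mulg1. Qed.

Let lift_letter (l : letter X) : S :=
  match l with inl x => f x | inr x => inv (f x) end.

Let lift_word (w : word X) : S := foldr (fun l s => lift_letter l * s) 1 w.

Let lift_cat u v : lift_word (u ++ v) = lift_word u * lift_word v.
Proof. by elim: u => [|l u /= ->]; rewrite ?mul1g ?mulgA. Qed.

Let lift_inv u : lift_word (word_inv u) = inv (lift_word u).
Proof.
elim: u => [|l u IH] /=; first by rewrite inv1.
rewrite -[l :: u]cat1s word_inv_cat lift_cat IH invM /= mulg1.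
by case: l => x //=; rewrite invK.
Qed.

Let lift_vagner u v : vagner u v -> lift_word u = lift_word v.
Proof.
elim=> {u v} [u|u v|u u' v v' _ h _ h'|u|u v _ h|v u w _ h _ h'] //.
- by rewrite !lift_cat lift_inv mulgA (invP _).1.
- rewrite !lift_cat !lift_inv mulgA [RHS]mulgA.
  exact: idem_comm (idem_r _) (idem_r _).
- by rewrite !lift_cat h h'.
- by rewrite h.
Qed.

Lemma FIM_free : exists! g : FIM X -> S,
  [/\ g 1 = 1, {morph g : s t / s * t} & forall x, g (fim_pi [:: inl x]) = f x].
Proof.
pose g (s : FIM X) := lift_word (repr s).
have gE w : g (fim_pi w) = lift_word w.
  by apply/lift_vagner/fim_piP; rewrite /fim_pi reprK.
exists g; split=> [|h [h1 hM hf]].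
  split=> [|s t|x]; first by rewrite -fim_pi1 gE.
    have [[u ->] [v ->]] := (fim_pi_surj s, fim_pi_surj t).
    by rewrite -fim_piM !gE lift_cat.
  by rewrite gE /= mulg1.
apply/funext => s; have [w ->] := fim_pi_surj s; rewrite gE.
elim: w => [|l w IH] /=; first by rewrite fim_pi1 h1.
rewrite -cat1s fim_piM hM IH; congr (_ * _); case: l => x /=; first by rewrite hf.
apply: inv_uniq; rewrite -hf; split; rewrite -!hM; congr (h _).
  exact: (fim_piVK [:: inl x]).
exact: (fim_piVK [:: inr x]).
Qed.

End FIMFree.

(* Main.v *)
Require Import Defs.
From mathcomp Require Import all_boot.
From mathcomp Require Import boolp classical_sets.
From mathcomp Require Import order ssralg ssrnum ssrint zify.
Local Open Scope classical_set_scope.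

(** Since H-related elements are both R- and L-related, minimality over an
    R-class or an L-class is stronger than minimality over an H-class; this
    gives the inclusion.  The content is that the word w = a^2 a^-4 a is
    H-geodesic but neither R- nor L-geodesic.

    The word w is a walk on the line that climbs from 0 to 2, descends to -2
    and steps back to -1.  Its R-class only remembers the range [-2, 2] seen
    from the start of the walk, so dropping the last step gives the shorter
    R-related word a^2 a^-4.  Its L-class only remembers the range seen from
    the end of the walk, so dropping the first two steps gives the shorter
    L-related word a^-4 a.  The H-class remembers both, hence range and
    endpoint: a walk from 0 that visits 2 and -2 and ends at -1 needs at least
    2 + 4 + 1 = 7 steps.

    The part of Munn's description of the free inverse monoid that this uses is
    as follows.  A weight f : X -> int turns every word into a walk on the
    integers, with endpoint [height f] and maximum [peak f]; the minimum is
    [- peak (- f)].  Both are invariants of the Vagner congruence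
    ([vagner_height], [vagner_peak]).  The peak is an invariant of the R-class
    ([greenR_peak]), the difference peak - height one of the L-class
    ([greenL_peak]), and [walk_size] bounds the length of a walk from below by
    its range and endpoint. *)

(** * Geodesics and Green's relations *)

Lemma sub_Geo (X : choiceType) (K K' : FIM X -> FIM X -> Prop) :
  (forall s t, K s t -> K' s t) -> (forall s, K s s) ->
  Geo K' `<=` Geo K.
Proof.
move=> KK' Kxx w [_ wmin]; split; first by exists w => //; exact: Kxx.
by move=> _ [u /= Kuw <-]; apply: wmin; exists u => //; exact: KK'.
Qed.

Lemma shorter_notin_Geo (X : choiceType) (K : FIM X -> FIM X -> Prop)
    (u w : word X) :
  K (fim_pi u) (fim_pi w) -> (size u < size w)%N -> ~ Geo K w.
Proof.
move=> Kuw lt_uw [_ wmin]; have : (size w <= size u)%N.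
  by apply: wmin; exists u.
by rewrite leqNgt lt_uw.
Qed.

Lemma greenR_mulr (S : monoidType) (s x y : S) :
  (s * x * y)%g = s -> greenR s (s * x)%g.
Proof.
move=> sxy; apply/seteqP; split=> _ [z _ <-].
  by exists (y * z)%g => //; rewrite mulgA sxy.
by exists (x * z)%g => //; rewrite mulgA.
Qed.

Lemma greenL_mull (S : monoidType) (s x y : S) :
  (y * (x * s))%g = s -> greenL s (x * s)%g.
Proof.
move=> yxs; apply/seteqP; split=> _ [z _ <-].
  by exists (z * y)%g => //; rewrite -mulgA yxs.
by exists (z * x)%g => //; rewrite mulgA.
Qed.

Lemma vagner_greenR (X : choiceType) (u v v' : word X) :
  vagner u (u ++ v ++ v') -> greenR (fim_pi u) (fim_pi (u ++ v)).
Proof.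
move=> /fim_piP uvv'; rewrite fim_piM; apply: (greenR_mulr _ _ _ (fim_pi v')).
by rewrite [RHS]uvv' !fim_piM mulgA.
Qed.

Lemma vagner_greenL (X : choiceType) (u v v' : word X) :
  vagner u (v' ++ v ++ u) -> greenL (fim_pi u) (fim_pi (v ++ u)).
Proof.
move=> /fim_piP uvv'; rewrite fim_piM; apply: (greenL_mull _ _ _ (fim_pi v')).
by rewrite [RHS]uvv' !fim_piM.
Qed.

Lemma greenR_mul (S : monoidType) (s t : S) :
  greenR s t -> exists x, t = (s * x)%g.
Proof.
move=> st; have : [set (t * x)%g | x in [set: S]] t.
  by exists 1%g => //; rewrite mulg1.
by rewrite -st => -[x _ <-]; exists x.
Qed.

Lemma greenL_mul (S : monoidType) (s t : S) :
  greenL s t -> exists x, t = (x * s)%g.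
Proof.
move=> st; have : [set (x * t)%g | x in [set: S]] t.
  by exists 1%g => //; rewrite mul1g.
by rewrite -st => -[x _ <-]; exists x.
Qed.

(** * The walk of a word *)

Section Walk.
Local Open Scope ring_scope.
Variables (X : choiceType) (f : X -> int).
Implicit Types (l : letter X) (u v w : word X).

Definition step l : int := match l with inl x => f x | inr x => - f x end.

Fixpoint height w : int := if w is l :: v then step l + height v else 0.

(** The start of the walk counts, so the peak is never negative. *)
Fixpoint peak w : int :=
  if w is l :: v then Num.max 0 (step l + peak v) else 0.

Lemma peak_ge0 w : 0 <= peak w.
Proof. by case: w => //= l w; lia. Qed.

Lemma height_le_peak w : height w <= peak w.
Proof. by elim: w => //= l w IH; lia. Qed.

Lemma height_cat u v : height (u ++ v) = height u + height v.
Proof. by elim: u => [|l u /= ->] /=; lia. Qed.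

Lemma peak_cat u v : peak (u ++ v) = Num.max (peak u) (height u + peak v).
Proof.
elim: u => [|l u /= ->] /=; last by lia.
by have := peak_ge0 v; lia.
Qed.

Lemma word_inv_cons l u : word_inv (l :: u) = word_inv u ++ [:: letter_inv l].
Proof. by rewrite /word_inv /= rev_cons cats1. Qed.

Lemma height_inv u : height (word_inv u) = - height u.
Proof.
elim: u => // l u IH; rewrite word_inv_cons height_cat IH /=.
by case: l => x /=; lia.
Qed.

(** The inverse word runs the walk backwards, starting from its end. *)
Lemma peak_inv u : peak (word_inv u) = peak u - height u.
Proof.
elim: u => // l u IH; rewrite word_inv_cons peak_cat IH height_inv /=.
by have := peak_ge0 u; case: l => x /=; lia.
Qed.

Lemma vagner_height u v : vagner u v -> height u = height v.
Proof.
elim=> {u v} [u|u v|u u' v v' _ h _ h'|u|u v _ h|v u w _ h _ h'] //.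
- by rewrite !height_cat height_inv; lia.
- by rewrite !height_cat !height_inv; lia.
- by rewrite !height_cat h h'.
- by rewrite h.
Qed.

(** The word u u^-1 retraces the walk of u back to 0, so it has the peak of u
    and the order of two such excursions does not matter. *)
Lemma vagner_peak u v : vagner u v -> peak u = peak v.
Proof.
elim=> {u v} [u|u v|u u' v v' hu h _ h'|u|u v _ h|v u w _ h _ h'] //.
- by rewrite !peak_cat peak_inv height_inv; have := peak_ge0 u; lia.
- by rewrite !peak_cat !peak_inv !height_inv; lia.
- by rewrite !peak_cat h h' (vagner_height _ _ hu).
- by rewrite h.
Qed.

Lemma greenR_peak_le u v : greenR (fim_pi u) (fim_pi v) -> peak u <= peak v.
Proof.
move=> /greenR_mul[s]; have [x ->] := fim_pi_surj s.
by rewrite -fim_piM => /fim_piP/vagner_peak ->; rewrite peak_cat; lia.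
Qed.

Lemma greenR_peak u v : greenR (fim_pi u) (fim_pi v) -> peak u = peak v.
Proof.
move=> uv; have := greenR_peak_le _ _ uv.
by have := greenR_peak_le _ _ (esym uv); lia.
Qed.

Lemma greenL_peak_le u v : greenL (fim_pi u) (fim_pi v) ->
  peak u - height u <= peak v - height v.
Proof.
move=> /greenL_mul[s]; have [x ->] := fim_pi_surj s.
rewrite -fim_piM => /fim_piP vxu.
rewrite (vagner_peak _ _ vxu) (vagner_height _ _ vxu) peak_cat height_cat; lia.
Qed.

Lemma greenL_peak u v : greenL (fim_pi u) (fim_pi v) ->
  peak u - height u = peak v - height v.
Proof.
move=> uv; have := greenL_peak_le _ _ uv.
by have := greenL_peak_le _ _ (esym uv); lia.
Qed.

End Walk.

Lemma heightN (X : choiceType) (f : X -> int) (w : word X) :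
  height X (fun x => - f x)%R w = (- height X f w)%R.
Proof. by elim: w => // -[x|x] w /= ->; lia. Qed.

(** A walk with maximum M, minimum -N and endpoint e that reaches M first has
    to make M + (M + N) + (N + e) unit steps; if it reaches -N first, it has to
    make N + (M + N) + (M - e).  In both cases this is at least
    2 M + 2 N - |e|. *)
Lemma walk_size (X : choiceType) (f : X -> int) (w : word X) :
  (forall x, `|f x| <= 1)%R ->
  (peak X f w *+ 2 + peak X (fun x => - f x) w *+ 2
     <= (size w)%:Z + `|height X f w|)%R.
Proof.
move=> f1; elim: w => // l w /=.
have := height_le_peak X f w.
have := height_le_peak X (fun x => - f x)%R w; rewrite heightN.
have := peak_ge0 X f w; have := peak_ge0 X (fun x => - f x)%R w.
by case: l => x /=; have := f1 x; lia.
Qed.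

(** * The word a^2 a^-4 a *)

Section Example.
Variables (X : choiceType) (a : X).

Definition zigzag : word X :=
  nseq 2 (inl a) ++ nseq 4 (inr a) ++ [:: inl a].

Lemma zigzag_GeoH : Geo (@greenH (FIM X)) zigzag.
Proof.
split; first by exists zigzag.
move=> _ [u /= [uLw uRw] <-].
pose f x : int := if x == a then 1%R else 0%R.
have f1 x : (`|f x| <= 1)%R by rewrite /f; case: ifP.
have := walk_size X f u f1.
have := greenR_peak X f _ _ uRw.
have := greenR_peak X (fun x => - f x)%R _ _ uRw.
have := greenL_peak X f _ _ uLw.
by rewrite /= /f eqxx; lia.
Qed.

(** The last step is undone by a^-1, which already ends a^2 a^-4. *)
Lemma zigzag_not_GeoR : ~ Geo (@greenR (FIM X)) zigzag.
Proof.
apply: (@shorter_notin_Geo _ _ (nseq 2 (inl a) ++ nseq 4 (inr a))) => //.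
rewrite /zigzag catA; apply: (@vagner_greenR _ _ _ [:: inr a]).
exact: (vagner_cat (vagner_refl [:: inl a; inl a; inr a; inr a; inr a])
                   (vagner_regular [:: inr a])).
Qed.

(** The first two steps are undone by a^-2, which already starts a^-4 a. *)
Lemma zigzag_not_GeoL : ~ Geo (@greenL (FIM X)) zigzag.
Proof.
apply: (@shorter_notin_Geo _ _ (nseq 4 (inr a) ++ [:: inl a])) => //.
apply: (@vagner_greenL _ _ _ [:: inr a; inr a]).
exact: (vagner_cat (vagner_regular [:: inr a; inr a])
                   (vagner_refl [:: inr a; inr a; inl a])).
Qed.

End Example.

Theorem mainTheorem3 (X : finType) :
  [/\ Geo (@greenR (FIM X)) `|` Geo (@greenL (FIM X))
        `<=` Geo (@greenH (FIM X)),
      (0 < #|X|)%N ->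
        Geo (@greenR (FIM X)) `|` Geo (@greenL (FIM X))
          `<` Geo (@greenH (FIM X))
    & forall a : X,
        let w : word X := nseq 2 (inl a) ++ nseq 4 (inr a) ++ [:: inl a] in
        [/\ Geo (@greenH (FIM X)) w,
            ~ Geo (@greenL (FIM X)) w
          & ~ Geo (@greenR (FIM X)) w]].
Proof.
have incl : Geo (@greenR (FIM X)) `|` Geo (@greenL (FIM X))
    `<=` Geo (@greenH (FIM X)).
  by rewrite subUset; split; apply: sub_Geo => // s t [].
split=> // [/card_gt0P[a _]|a w].
  split=> // /(_ _ (zigzag_GeoH X a)) [].
    exact: zigzag_not_GeoR.
  exact: zigzag_not_GeoL.
split; [exact: zigzag_GeoH|exact: zigzag_not_GeoL|exact: zigzag_not_GeoR].
Qed.
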